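(* Let $p$ be an odd prime and let $G$ be a finite $p$-group of nilpotency class at most $p-1$. Then $\exp(G\wedge G)$ divides $\exp(G)$. In particular, $\exp(M(G))$ divides $\exp(G)$.
   Context: Conventions: ${}^g h = ghg^{-1}$ and $[g,h]=ghg^{-1}h^{-1}$. The nonabelian tensor square $G\otimes G$ is the group generated by symbols $g\otimes h$ ($g,h\in G$) subject to the relations $gg'\otimes h=({}^g g'\otimes {}^g h)(g\otimes h)$ and $g\otimes hh'=(g\otimes h)({}^h g\otimes {}^h h')$ for all $g,g',h,h'\in G$. The exterior square is $G\wedge G=(G\otimes G)/\nabla(G)$, where $\nabla(G)$ is the subgroup generated by all $x\otimes x$, $x\in G$; the image of $g\otimes h$ is written $g\wedge h$. There is a homomorphism $\kappa:G\wedge G\to [G,G]$, $g\wedge h\mapsto [g,h]$, and $M(G)=\ker\kappa\cong H_2(G,\mathbb{Z})$ is the Schur multiplier. $\exp(X)$ denotes the exponent of a group $X$. *)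

(* Defs.v *)
(* The nonabelian exterior square G /\ G of a finite group
   G (= the whole finGroupType gT) is built literally as the group given by
   the presentation in the paper: words in the symbols g (x) h and their
   inverses, modulo the congruence generated by free cancellation, the two
   defining relations of the tensor square, and the relators x (x) x
   (which generate nabla(G)). *)
From mathcomp Require Import all_boot all_fingroup all_solvable.
Set Implicit Arguments. Unset Strict Implicit. Unset Printing Implicit Defensive.
Local Open Scope group_scope.

Section ExteriorSquare.
Variable gT : finGroupType.

(* Paper conventions: ^g h = g h g^-1 ; [g,h] = g h g^-1 h^-1. *)
Definition lconj (g h : gT) : gT := h ^ g^-1.
Definition lcomm (g h : gT) : gT := g * h * g^-1 * h^-1.

(* a letter ((g,h),b): the symbol g /\ h if b = false, its inverse if b = true *)
Definition letter := ((gT * gT) * bool)%type.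
Definition word := seq letter.
Definition gen (g h : gT) : word := [:: ((g, h), false)].
Definition wpow (w : word) (n : nat) : word := flatten (nseq n w).

Inductive ext_rel : word -> word -> Prop :=
| er_refl w : ext_rel w w
| er_sym u v : ext_rel u v -> ext_rel v u
| er_trans u v w : ext_rel u v -> ext_rel v w -> ext_rel u w
| er_cat u u' v v' : ext_rel u u' -> ext_rel v v' -> ext_rel (u ++ v) (u' ++ v')
| er_free (a : letter) : ext_rel [:: a; (a.1, ~~ a.2)] [::]
| er_tens_l (g g' h : gT) :
    ext_rel (gen (g * g') h) (gen (lconj g g') (lconj g h) ++ gen g h)
| er_tens_r (g h h' : gT) :
    ext_rel (gen g (h * h')) (gen g h ++ gen (lconj h g) (lconj h h'))
| er_nabla (x : gT) : ext_rel (gen x x) [::].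

Definition kappa (w : word) : gT :=
  foldr (fun a acc => (if a.2 then (lcomm a.1.1 a.1.2)^-1
                       else lcomm a.1.1 a.1.2) * acc) 1 w.

Definition ext_exp_dvd (n : nat) : Prop :=
  forall w : word, ext_rel (wpow w n) [::].

(* exp(M(G)) divides n, with M(G) = ker kappa *)
Definition mult_exp_dvd (n : nat) : Prop :=
  forall w : word, kappa w = 1 -> ext_rel (wpow w n) [::].

End ExteriorSquare.

(* Main.v *)
(* Call q = exp(G), a power of p. In a finite group of class < p, x^q = y^q
   implies (x^-1 y)^q = 1. By induction on the class one may assume that the
   derived subgroup of <x, y> has exponent dividing q, so it suffices that
   (xy)^q = x^q y^q in that case. By induction the defect w(x, y) of this
   identity lies in the last term of the lower central series, the c-th one,
   c > 1. Replacing (x, y) by (x^m, y^m) raises w to the power m^c because w is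
   a product of c-fold commutators, and to the power m because q-th powers are
   central and only depend on classes modulo the derived subgroup. Choosing m
   with m^(c-1) <> 1 mod p kills w. The substitution is carried out inside the
   subgroup of the direct square generated by (x, x^m) and (y, y^m).

   The exterior square E of G is a crossed module over G, in which
   kappa(u) /\ g = u (^g u)^-1. Hence the subgroups E_n generated by
   gamma_n(G) /\ G satisfy [E_n, G] <= E_(n+1); their successive quotients are
   finitely generated abelian and torsion, so E is finite, and the
   semidirect product L = E <g> has class at most that of G, because
   gamma_n(L) <= E_n for n > 1. In L one has
   (g (g /\ h))^n = g^n (g^n /\ h), up to conventions, so that g and g (g /\ h)
   both have trivial q-th power; hence (g /\ h)^q = 1, and these elements
   generate E. *)
From HB Require Import structures.
Require Import Defs.
From mathcomp Require Import all_boot all_fingroup all_solvable.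
From mathcomp Require Import all_algebra.
From mathcomp Require boolp.
Set Implicit Arguments. Unset Strict Implicit. Unset Printing Implicit Defensive.
Local Open Scope group_scope.

(** * Lower central series and commutators *)

Lemma coset_eq_mulVg (gT : finGroupType) (N : {group gT}) a b :
  a \in 'N(N) -> b \in 'N(N) -> coset N a = coset N b -> a^-1 * b \in N.
Proof.
move=> na nb eqab; rewrite coset_idr ?groupM ?groupV // morphM ?groupV //.
by rewrite morphV //= eqab mulVg.
Qed.

Lemma der1_joing_cycle (gT : finGroupType) (a : gT) (D N : {group gT}) :
    <[a]> <*> D \subset 'N(N) -> [~: D, <[a]> <*> D] \subset N ->
  (<[a]> <*> D)^`(1) \subset N.
Proof.
set K := _ <*> _ => nNK sDKN; have := nNK; rewrite join_subG => /andP[nNa nND].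
rewrite der1_min // quotientY // abelianY.
have cD : D / N \subset 'C(K / N) by rewrite quotient_cents2.
rewrite quotient_abelian ?cycle_abelian //.
by rewrite /abelian !(subset_trans cD) ?centS ?quotientS ?joing_subl ?joing_subr.
Qed.

Section LowerCentral.
Variables (gT : finGroupType) (G : {group gT}).

Lemma lcn_quotient n (N : {group gT}) :
  N <| G -> 'L_n(G / N) = 'L_n(G) / N.
Proof. by move=> /andP[_ nNG]; rewrite -morphim_lcn. Qed.

Lemma lcn_quotient_lcn n : 'L_n(G / 'L_n(G)) = 1.
Proof. by rewrite lcn_quotient ?lcn_normal // trivg_quotient. Qed.

Lemma lcn_last_central n : 'L_n.+2(G) = 1 -> 'L_n.+1(G) \subset 'C(G).
Proof. by move=> L1; apply/commG1P; rewrite -lcnSn. Qed.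

(** Three subgroups lemma: the other two commutators both equal the trivial ['L_n.+3(G)]. In
    [scale_lcn] it makes an error factor from the derived subgroup harmless. *)
Lemma commg_der_lcn n : 'L_n.+3(G) = 1 -> [~: G^`(1), 'L_n.+1(G)] = 1.
Proof.
move=> L1; apply: three_subgroup; rewrite ?[[~: G, _]]commGC -!lcnSn //.
Qed.

(** This drop of the class by one drives the later inductions. As [<[a]>] is abelian, the derived
    subgroup of [K] comes from commutators with the derived subgroup of [G], so it already lies in
    ['L_3(G)]. *)
Lemma lcn_cycle_der n a :
  a \in G -> 'L_n.+2(<[a]> <*> G^`(1)) \subset 'L_n.+3(G).
Proof.
move=> Ga; set K := _ <*> _.
have sKG: K \subset G by rewrite join_subG cycle_subG Ga der_sub.
elim: n => [|n IHn]; last by rewrite lcnSn (lcnSn n.+2) commgSS.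
rewrite lcn2; apply: der1_joing_cycle.
  exact: subset_trans (lcn_norm 3 G).
exact: commgS.
Qed.

End LowerCentral.

(** Bilinearity in the presence of error factors: [s] drops out because it commutes with [a], [g]
    and [d], and [d] because it commutes with [a], [s] and the commutator. *)
Lemma commg_scale (gT : finGroupType) (a g s d : gT) i j :
  commute s a -> commute s g -> commute s d -> commute d a ->
  commute a [~ a, g] -> commute g [~ a, g] -> commute d [~ a, g] ->
  [~ a ^+ i * s, g ^+ j * d] = [~ a, g] ^+ (i * j).
Proof.
move=> csa csg csd cda cac cgc cdc.
have ->: [~ a ^+ i * s, g ^+ j * d] = [~ a ^+ i * s, g ^+ j] ^ d.
  rewrite commgMJ; have /commgP/eqP->: commute (a ^+ i * s) d.
    by apply/commute_sym/commuteM; [apply: commuteX | apply: commute_sym].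
  by rewrite mul1g.
have ->: [~ a ^+ i * s, g ^+ j] = [~ a, g] ^+ (i * j).
  rewrite commMgJ; have /commgP/eqP->: commute s (g ^+ j) by apply: commuteX.
  rewrite mulg1 commXXg //.
  apply/conjg_fixP/commgP/commute_sym/commuteX.
  rewrite commgEl /conjg; apply: commuteM; first exact: commuteV.
  by do ![apply: commuteM | apply: commuteV].
by apply/conjg_fixP/commgP/commute_sym/commuteX.
Qed.

(** * Homomorphisms related by a power map on generators *)

Lemma image_lcn (rT gT : finGroupType) (F : {group rT}) (G : {group gT})
    (f : rT -> gT) n u :
  {in F &, {morph f : x y / x * y}} -> {in F, forall x, f x \in G} ->
  u \in 'L_n(F) -> f u \in 'L_n(G).
Proof.
move=> fM fG Lu; pose f' := Morphism fM.
have Fu : u \in F by apply: subsetP Lu; apply: lcn_sub.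
have: f' u \in f' @* 'L_n(F) by rewrite mem_morphim.
rewrite morphim_lcn //; apply: (subsetP (lcnS n _)).
by apply/subsetP=> _ /morphimP[x _ Fx ->]; apply: fG.
Qed.

Lemma scale_gen (rT gT : finGroupType) (F : {group rT}) (A : {set rT})
    (f g : rT -> gT) i :
  A \subset F -> {in F &, {morph f : x y / x * y}} ->
  {in F &, {morph g : x y / x * y}} ->
  {in <<A>> &, forall x y, commute (f x) (f y)} ->
  {in A, forall x, g x = f x ^+ i} -> {in <<A>>, forall x, g x = f x ^+ i}.
Proof.
move=> sAF fM gM cff gf.
have sF : <<A>> \subset F by rewrite gen_subG.
have gS : group_set [set x in <<A>> | g x == f x ^+ i].
  apply/group_setP; split=> [|x y].
    have [f1 g1] := (morph1 (Morphism fM), morph1 (Morphism gM)).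
    by rewrite /= in f1 g1; rewrite inE group1 f1 g1 expg1n /=.
  rewrite !inE => /andP[Ax /eqP gx] /andP[Ay /eqP gy].
  have [Fx Fy] := (subsetP sF x Ax, subsetP sF y Ay).
  rewrite groupM // gM // gx gy fM // expgMn ?eqxx //; exact: cff.
suff /subsetP sA: <<A>> \subset Group gS.
  by move=> x /sA; rewrite inE => /andP[_ /eqP].
by rewrite gen_subG; apply/subsetP=> x Ax; rewrite inE mem_gen // gf /=.
Qed.

(** In class at most [k.+1], commutators of [k.+1] entries are multilinear. Two homomorphisms are
    compared because raising generators to the power [m] need not extend to an endomorphism. *)
Lemma scale_lcn m k : forall (rT gT : finGroupType) (A : {set rT})
    (G : {group gT}) (f g : rT -> gT),
  {in <<A>> &, {morph f : x y / x * y}} -> {in <<A>>, forall x, f x \in G} ->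
  {in <<A>> &, {morph g : x y / x * y}} -> {in <<A>>, forall x, g x \in G} ->
  {in A, forall x, g x = f x ^+ m} -> 'L_k.+2(G) = 1 ->
  {in 'L_k.+1(<<A>>), forall u, g u = f u ^+ (m ^ k.+1)}.
Proof.
elim: k => [|k IHk] rT gT A G f g fM fG gM gG gf L1.
  have cGG: abelian G by apply/commG1P.
  rewrite lcn1 expn1; apply: (scale_gen _ fM gM _ gf); first exact: subset_gen.
  by move=> x y Ax Ay; apply: (centsP cGG); apply: fG.
have fL n u : u \in 'L_n(<<A>>) -> f u \in 'L_n(G) by apply: image_lcn fM fG.
(* The scaling rule in the quotient by ['L_n.+2(G)] determines [g x] up to a factor in that term.
   The case [n = k] leaves a central error [s], the case [n = 0] an error [d] in the derived
   subgroup. *)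
have step n : (forall (G' : {group coset_of 'L_n.+2(G)})
    (f' g' : rT -> coset_of 'L_n.+2(G)),
    {in <<A>> &, {morph f' : x y / x * y}} -> {in <<A>>, forall x, f' x \in G'} ->
    {in <<A>> &, {morph g' : x y / x * y}} -> {in <<A>>, forall x, g' x \in G'} ->
    {in A, forall x, g' x = f' x ^+ m} -> 'L_n.+2(G') = 1 ->
    {in 'L_n.+1(<<A>>), forall u, g' u = f' u ^+ (m ^ n.+1)}) ->
  forall x, x \in 'L_n.+1(<<A>>) ->
  exists2 s, s \in 'L_n.+2(G) & g x = f x ^+ (m ^ n.+1) * s.
- move=> IH x Lx; exists ((f x ^+ (m ^ n.+1))^-1 * g x); last by rewrite mulKVg.
  have nL y : y \in G -> y \in 'N('L_n.+2(G)) by apply/subsetP/lcn_norm.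
  have Ax : x \in <<A>> by apply: subsetP (lcn_sub _ _) _ Lx.
  apply: coset_eq_mulVg; rewrite ?groupX ?nL ?fG ?gG // morphX ?nL ?fG //.
  apply/esym.
  apply: (IH (G / 'L_n.+2(G))%G (coset _ \o f) (coset _ \o g)) => //=;
    last exact: lcn_quotient_lcn.
  + by move=> y z Ay Az /=; rewrite fM // morphM //; apply/nL/fG.
  + by move=> y Ay /=; rewrite mem_quotient ?fG.
  + by move=> y z Ay Az /=; rewrite gM // morphM //; apply/nL/gG.
  + by move=> y Ay /=; rewrite mem_quotient ?gG.
  + by move=> y Ay /=; rewrite gf // morphX //; apply/nL/fG/mem_gen.
have cL : 'L_k.+2(G) \subset 'C(G) by apply: lcn_last_central.
rewrite lcnSn; apply: (scale_gen _ fM gM) => [|u v|_ /imset2P[v w Lv Aw ->]].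
- by rewrite -gen_subG -/(commutator _ _) -lcnSn lcn_sub.
- rewrite -/(commutator _ _) -lcnSn => Lu Lv.
  apply: (centsP cL); first exact: fL.
  exact: subsetP (lcn_sub _ _) _ (fL _ _ Lv).
have Av: v \in <<A>> by apply: subsetP (lcn_sub _ _) _ Lv.
have homR (h : rT -> gT) : {in <<A>> &, {morph h : x y / x * y}} ->
    h [~ v, w] = [~ h v, h w].
  by move=> hM; have /= := morphR (Morphism hM) Av Aw.
rewrite (homR _ fM) (homR _ gM).
have [s Ls ->] := step k (fun G' f' g' => IHk _ _ A G' f' g') v Lv.
have [|//|d Ld ->] := step 0 _ w.
- move=> G' f' g' fM' fG' gM' _ gf' cG'; rewrite lcn1 expn1.
  apply: (scale_gen _ fM' gM' _ gf'); first exact: subset_gen.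
  by move=> x y Ax Ay; apply: (centsP (introT commG1P cG')); apply: fG'.
have Lfv := fL _ _ Lv; have Gfv := fG _ Av; have Gfw := fG _ Aw.
have Lc : [~ f v, f w] \in 'L_k.+2(G) by rewrite lcnSn mem_commg.
have Gd := subsetP (lcn_sub _ _) _ Ld.
have cd : commute d (f v).
  by apply: (centsP (introT commG1P (commg_der_lcn L1))).
rewrite expn1 commg_scale -?expnSr //; try by apply: (centsP cL).
all: by apply: commute_sym; apply: (centsP cL).
Qed.

(** * Residues moved by a power map *)

Section NonFixedResidue.
Import GRing.Theory.
Local Open Scope ring_scope.

(** The polynomial ['X^c - 'X] has degree [c < p], so it cannot vanish on all of ['F_p]. *)
Lemma exists_expn_neq_mod p c :
  prime p -> (1 < c < p)%N -> exists2 m, (0 < m)%N & ~~ (p %| m ^ c - m)%N.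
Proof.
move=> p_pr /andP[c_gt1 c_ltp].
have sz : size ('X^c - 'X : {poly 'F_p}) = c.+1.
  by rewrite size_polyDl size_polyXn // size_polyN size_polyX.
have nz : ('X^c - 'X : {poly 'F_p}) != 0 by rewrite -size_poly_eq0 sz.
case: (boolP (all (root ('X^c - 'X : {poly 'F_p})) (enum 'F_p))) => [allr|].
  have := max_poly_roots nz allr (enum_uniq _).
  by rewrite sz -cardE card_Fp // ltnS leqNgt c_ltp.
case/allPn=> a _; rewrite rootE !hornerE => nza.
have a0 : (0 < (a : nat))%N.
  rewrite lt0n; apply: contraNneq nza => a0.
  have -> : a = 0 by apply: val_inj.
  by rewrite expr0n; case: (c) c_gt1 => //= ? _; rewrite subrr.
exists (a : nat) => //; apply: contra nza => dv.
(* This makes the truncated subtraction a genuine one, so that it can be cast into ['F_p]. *)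
have le : (a <= a ^ c)%N by rewrite -{1}[a : nat]expn1 leq_pexp2l // ltnW.
have := dv; rewrite (dvdn_pcharf (pchar_Fp p_pr)) natrB // natrX.
by rewrite natr_Zp.
Qed.

End NonFixedResidue.

(** * Powers of exponent [q] in groups of class less than [p] *)

Lemma expg_gen (gT : finGroupType) (A : {set gT}) q :
  {in <<A>> &, forall u v, u ^+ q = v ^+ q -> (u^-1 * v) ^+ q = 1} ->
  {in A, forall u, u ^+ q = 1} -> {in <<A>>, forall u, u ^+ q = 1}.
Proof.
move=> mulVq Aq.
have gS : group_set [set u in <<A>> | u ^+ q == 1].
  apply/group_setP; split=> [|u v]; first by rewrite inE group1 expg1n /=.
  rewrite !inE => /andP[Au /eqP uq] /andP[Av /eqP vq].
  rewrite groupM //= -[u]invgK; apply/eqP.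
  by apply: mulVq; rewrite ?groupV // expgVn uq vq invg1.
suff /subsetP sA : <<A>> \subset Group gS.
  by move=> u /sA; rewrite inE => /andP[_ /eqP].
by rewrite gen_subG; apply/subsetP=> u Au; rewrite inE mem_gen // Aq /=.
Qed.

Section PowerAdditive.
Variables (p k : nat).
Hypothesis p_pr : prime p.
Local Notation q := (p ^ k)%N.

Lemma expgMn_der c : forall (gT : finGroupType) (G : {group gT}) x y,
  c < p -> 'L_c.+1(G) = 1 -> {in G^`(1), forall d, d ^+ q = 1} ->
  x \in G -> y \in G -> (x * y) ^+ q = x ^+ q * y ^+ q.
Proof.
elim: c => [|[|n] IHn] gT G x y c_ltp L1 dq Gx Gy.
- move: Gx Gy; rewrite -(lcn1 G) L1 => /set1P-> /set1P->.
  by rewrite mulg1 !expg1n mulg1.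
- have cGG : abelian G by apply/commG1P.
  by rewrite expgMn //; apply: (centsP cGG).
(* The induction hypothesis applies to [K], whose class is smaller, and [d] has trivial [q]-th
   power. *)
have expMd u d : u \in G -> d \in G^`(1) -> (u * d) ^+ q = u ^+ q.
  move=> Gu Gd; pose K := (<[u]> <*> G^`(1))%G.
  have sKG : K \subset G by rewrite join_subG cycle_subG Gu der_sub.
  have Ku : u \in K by apply: (subsetP (joing_subl _ _)); apply: cycle_id.
  have Kd : d \in K by apply: (subsetP (joing_subr _ _)).
  rewrite (IHn _ K) ?(ltnW c_ltp) ?(dq d) ?mulg1 //.
    by apply/eqP; rewrite -subG1 -L1; apply: lcn_cycle_der.
  by move=> e Ke; apply: dq; apply: subsetP (dergS 1 sKG) _ Ke.
have expC u v : u \in G -> v \in G -> commute (u ^+ q) v.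
  move=> Gu Gv; apply/commgP/conjg_fixP.
  by rewrite conjXg conjg_mulR expMd // mem_commg.
(* The exponent is [n.+2] because the defect [W] will lie in ['L_n.+2], the last term that may be
   nontrivial. *)
have [m m_gt0 m_nscale] : exists2 m, 0 < m & ~~ (p %| m ^ n.+2 - m)%N.
  by apply: exists_expn_neq_mod.
pose W (rT : finGroupType) (u v : rT) := (u ^+ q * v ^+ q)^-1 * (u * v) ^+ q.
suff W1 : W _ x y = 1.
  by apply/esym/eqP; rewrite eq_mulVg1; apply/eqP.
(* On [F] the two projections are homomorphisms, and on the generators the second is the [m]-th
   power of the first, as [scale_lcn] requires. *)
pose X := (x, x ^+ m); pose Y := (y, y ^+ m); pose F := <<[set X; Y]>>%G.
have FX : X \in F by rewrite mem_gen // !inE eqxx.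
have FY : Y \in F by rewrite mem_gen // !inE eqxx orbT.
have sFG : F \subset setX G G.
  by rewrite gen_subG subUset !sub1set !inE /= !groupX ?Gx ?Gy.
have fstF : {in F, forall u, u.1 \in G}.
  by move=> u /(subsetP sFG); rewrite inE => /andP[].
have sndF : {in F, forall u, u.2 \in G}.
  by move=> u /(subsetP sFG); rewrite inE => /andP[].
have fstM : {in F &, {morph fst : u v / u * v}} by [].
have sndM : {in F &, {morph snd : u v / u * v}} by [].
have fstX (u : gT * gT) i : (u ^+ i).1 = u.1 ^+ i.
  by apply: (morphX (fst_morphism gT gT)); rewrite inE.
have sndX (u : gT * gT) i : (u ^+ i).2 = u.2 ^+ i.
  by apply: (morphX (snd_morphism gT gT)); rewrite inE.
(* The induction hypothesis is used in [F / 'L_n.+2(F)]. Membership in a term of [F], not merely of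
   [G], is what lets [scale_lcn] compare the two projections of the defect. *)
have LW : W _ X Y \in 'L_n.+2(F).
  have nL := subsetP (lcn_norm n.+2 F).
  have [nX nY] := (nL _ FX, nL _ FY).
  apply: coset_eq_mulVg; rewrite ?groupM ?groupX ?groupM //.
  rewrite morphM ?groupX // !morphX ?groupM // morphM //.
  rewrite (IHn _ (F / 'L_n.+2(F))%G) ?(ltnW c_ltp) ?mem_quotient //.
    exact: lcn_quotient_lcn.
  move=> d; rewrite /= -quotient_der ?lcn_norm // => /morphimP[e Ne Fe ->].
  rewrite -morphX //; suff -> : e ^+ q = 1 by rewrite morph1.
  have [e1 e2] : e.1 \in G^`(1) /\ e.2 \in G^`(1).
    by split; [apply: (image_lcn (n := 2) fstM) | apply: (image_lcn (n := 2) sndM)].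
  by rewrite [_ ^+ _]surjective_pairing fstX sndX !dq.
have scale : W _ (x ^+ m) (y ^+ m) = W _ x y ^+ (m ^ n.+2).
  have := scale_lcn (m := m) fstM fstF sndM sndF _ L1 LW.
  rewrite /W /=. rewrite !(fstX, sndX) /=. apply.
  by move=> u /set2P[] ->.
have Gm u : u \in G -> u ^+ m \in G by apply: groupX.
have Wm : W _ (x ^+ m) (y ^+ m) = W _ x y ^+ m.
  rewrite /W.
  (* The factor [d] measures how far the [m]-th power is from multiplicative; [expMd] discards it
     after raising to the power [q], and centrality of [q]-th powers then pulls [m] out. *)
  have [d Gd ->] : exists2 d, d \in G^`(1) & x ^+ m * y ^+ m = (x * y) ^+ m * d.
    exists (((x * y) ^+ m)^-1 * (x ^+ m * y ^+ m)); last by rewrite mulKVg.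
    have [nx ny] : x \in 'N(G^`(1)) /\ y \in 'N(G^`(1)).
      by split; apply: (subsetP (der_norm 1 G)).
    apply: coset_eq_mulVg; rewrite ?groupM ?groupX ?groupM //.
    rewrite morphX ?groupM // 2?morphM ?groupX // expgMn ?morphX //.
    by apply: (centsP (der_abelian 0 G)); rewrite mem_quotient.
  rewrite expMd ?groupX ?groupM // -!expgM ![(m * _)%N]mulnC !expgM.
  rewrite -expgMn; last by apply: expC; rewrite ?groupX.
  rewrite -expgVn -expgMn //; apply/commute_sym/expC; first exact: groupM.
  by rewrite groupV !groupM ?groupX.
have Wq : W _ x y ^+ q = 1.
  have := image_lcn fstM fstF LW; rewrite {1}/W /= !fstX /= => LxyW.
  by apply: dq; apply: subsetP LxyW; apply: (lcn_sub_leq (n := 2)).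
(* The order of the defect divides a power of [p], while [p] does not divide this exponent; the
   exponent also annihilates the defect, which is therefore trivial. *)
have cop : coprime #[W _ x y] (m ^ n.+2 - m).
  have dvd : #[W _ x y] %| q by rewrite order_dvdn Wq.
  apply: coprime_dvdl dvd _; apply: coprimeXl; by rewrite prime_coprime.
have /eqP : W _ x y ^+ (m ^ n.+2 - m) = 1.
  apply: (mulgI (W _ x y ^+ m)).
  by rewrite -expgnDr subnKC -?scale ?Wm ?mulg1 // -{1}[m]expn1 leq_pexp2l.
rewrite -order_dvdn => dvd; have := cop; rewrite /coprime (gcdn_idPl dvd).
by rewrite order_eq1 => /eqP.
Qed.

Lemma expg_eq_mulVg c : forall (gT : finGroupType) (G : {group gT}) x y,
  c < p -> 'L_c.+1(G) = 1 -> x \in G -> y \in G ->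
  x ^+ q = y ^+ q -> (x^-1 * y) ^+ q = 1.
Proof.
elim: c => [|[|n] IHn] gT G x y c_ltp L1 Gx Gy eqxy.
- by move: Gx Gy; rewrite -(lcn1 G) L1 => /set1P-> /set1P->; rewrite mulVg expg1n.
- have cGG : abelian G by apply/commG1P.
  rewrite expgMn; first by rewrite expgVn eqxy mulVg.
  by apply: (centsP cGG); rewrite ?groupV.
have exp_gen (rT : finGroupType) (A : {set rT}) : 'L_n.+2(<<A>>) = 1 ->
    {in A, forall u, u ^+ q = 1} -> {in <<A>>, forall u, u ^+ q = 1}.
  move=> LA1; apply: expg_gen => u v Au Av.
  by apply: (IHn _ <<A>>%G); rewrite 1?ltnW.
pose H := <<[set x; y]>>%G.
have Hx : x \in H by rewrite mem_gen // !inE eqxx.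
have Hy : y \in H by rewrite mem_gen // !inE eqxx orbT.
have sHG : H \subset G by rewrite gen_subG subUset !sub1set Gx Gy.
have LH1 : 'L_n.+3(H) = 1.
  by apply/eqP; rewrite -subG1 -L1 lcnS.
have nZ : {in H, forall u, u \in 'N('Z(H))} by apply/subsetP/gFnorm.
(* This power equals [y ^+ q], so it commutes with both generators of [H]. *)
have Zxq : x ^+ q \in 'Z(H).
  rewrite inE groupX // /=; apply/centP=> u Hu.
  suff : H \subset 'C[x ^+ q] by move/subsetP/(_ u Hu)/cent1P/commute_sym.
  rewrite gen_subG subUset !sub1set; apply/andP; split; apply/cent1P.
    exact/commuteX.
  by rewrite eqxy; apply/commuteX.
(* Modulo the center the class drops and both generators have trivial [q]-th power, so by induction
   every [q]-th power vanishes there. *)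
have Zq : {in H, forall u, u ^+ q \in 'Z(H)}.
  move=> u Hu; rewrite coset_idr ?groupX ?nZ // morphX ?nZ //=.
  have LHZ : 'L_n.+2(H / 'Z(H)) = 1.
    rewrite lcn_quotient ?center_normal //; apply/eqP; rewrite -subG1 quotient_sub1.
      by rewrite subsetI lcn_sub lcn_last_central.
    by apply: subset_trans (lcn_sub _ _) _; apply: gFnorm.
  have sxy : [set x; y] \subset 'N('Z(H)).
    by rewrite subUset !sub1set !nZ.
  apply: (exp_gen _ ([set x; y] / 'Z(H))); rewrite -?quotient_gen ?mem_quotient //.
  move=> _ /morphimP[v Nv xyv ->]; rewrite -morphX //=; apply: coset_id.
  by case/set2P: xyv => ->; rewrite -?eqxy.
have sLder (K : {group gT}) a : 
    a \in H -> K \subset <[a]> <*> H^`(1) -> 'L_n.+2(K) = 1.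
  move=> Ha sK; apply/eqP; rewrite -subG1 -LH1.
  by apply: subset_trans (lcn_cycle_der n Ha); apply: lcnS.
(* A commutator is [a^-1 * a ^ b]. Both factors come from the subgroup generated by [a] and the
   derived subgroup, of smaller class, and [a] and [a ^ b] have the same [q]-th power because it is
   central. *)
have commq : {in commg_set H H, forall u, u ^+ q = 1}.
  move=> _ /imset2P[a b Ha Hb ->]; rewrite commgEl.
  apply: (IHn _ (<[a]> <*> H^`(1))%G); rewrite ?(sLder _ a) 1?ltnW //.
  - by apply: (subsetP (joing_subl _ _)); apply: cycle_id.
  - rewrite conjg_mulR groupM //.
      by apply: (subsetP (joing_subl _ _)); apply: cycle_id.
    by apply: (subsetP (joing_subr _ _)); apply: mem_commg.
  - have /setIP[_ /centP/(_ b Hb) cb] := Zq a Ha.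
    by rewrite -conjXg; apply/esym/conjg_fixP/commgP.
(* It remains to bound the exponent of the derived subgroup, which has smaller class and is
   generated by the commutators just treated. *)
rewrite (expgMn_der (c := n.+2) (G := H)) ?groupV // ?expgVn ?eqxy ?mulVg //.
apply: exp_gen commq; apply: (sLder (H^`(1))%G 1) => //.
exact: joing_subr.
Qed.

Lemma expg_gen_lcn c (gT : finGroupType) (A : {set gT}) :
  c < p -> 'L_c.+1(<<A>>) = 1 ->
  {in A, forall u, u ^+ q = 1} -> {in <<A>>, forall u, u ^+ q = 1}.
Proof.
move=> c_ltp LA1; apply: expg_gen => u v.
exact: (expg_eq_mulVg (G := <<A>>%G) c_ltp).
Qed.

End PowerAdditive.

(** * The exterior square as a group and as a crossed module *)

Section ExteriorSquareGroup.
Variable gT : finGroupType.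
Implicit Types (g h x y : gT) (u v w : word gT).
Local Open Scope quotient_scope.

(** Classical logic supplies the boolean relation that the quotient construction expects. *)
Definition ext_eq u v : bool := boolp.asbool (ext_rel u v).

Lemma ext_eqP u v : reflect (ext_rel u v) (ext_eq u v).
Proof. exact: boolp.asboolP. Qed.

Lemma ext_eq_equiv : equiv_class_of ext_eq.
Proof.
split=> [u | u v | v u w].
- exact/ext_eqP/er_refl.
- by apply/ext_eqP/ext_eqP; apply: er_sym.
- by move=> /ext_eqP uv /ext_eqP vw; apply/ext_eqP; apply: er_trans uv vw.
Qed.

Canonical ext_eq_equivRel := EquivRelPack ext_eq_equiv.

Definition extsq := {eq_quot ext_eq}.
HB.instance Definition _ := Choice.on extsq.
HB.instance Definition _ := EqQuotient.on extsq.

Definition cls w : extsq := \pi w.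
Definition rep (a : extsq) : word gT := generic_quotient.repr a.

Lemma repK a : cls (rep a) = a. Proof. exact: reprK. Qed.

Lemma clsP u v : cls u = cls v <-> ext_rel u v.
Proof.
split; first by move/eqP; rewrite /cls (pi_eq_quot (s := extsq)); apply/ext_eqP.
by move=> uv; apply/eqP; rewrite /cls (pi_eq_quot (s := extsq)); apply/ext_eqP.
Qed.

Definition winv w : word gT := rev [seq (a.1, ~~ a.2) | a <- w].

Lemma winv_cat u v : winv (u ++ v) = winv v ++ winv u.
Proof. by rewrite /winv map_cat rev_cat. Qed.

Lemma winvK : involutive winv.
Proof.
move=> w; rewrite /winv map_rev revK -map_comp map_id_in // => -[a b] _ /=.
by rewrite negbK.
Qed.

Lemma cat_winv w : ext_rel (w ++ winv w) [::].
Proof.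
elim: w => [|a w IHw]; first exact: er_refl.
rewrite -cat1s winv_cat -!catA; apply: er_trans (er_free a).
apply: (er_cat (er_refl [:: a])).
by rewrite catA -[X in ext_rel _ X]cat0s; apply: er_cat IHw (er_refl _).
Qed.

Lemma winv_ext u v : ext_rel u v -> ext_rel (winv u) (winv v).
Proof.
move=> uv; apply: (er_trans (v := winv u ++ (v ++ winv v))).
  by rewrite -{1}[winv u]cats0; apply: er_cat (er_refl _) (er_sym (cat_winv v)).
rewrite catA; apply: (er_trans (v := (winv u ++ u) ++ winv v)).
  by apply: er_cat (er_refl _); apply: er_cat (er_refl _) (er_sym uv).
rewrite -[X in ext_rel _ X]cat0s; apply: er_cat (er_refl _).
by rewrite -{2}[u]winvK; apply: cat_winv.
Qed.

Definition wact g w : word gT :=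
  [seq ((lconj g a.1.1, lconj g a.1.2), a.2) | a <- w].

Lemma lconjM g x y : lconj g (x * y) = lconj g x * lconj g y.
Proof. exact: conjMg. Qed.

Lemma lconj_mul g h x : lconj (g * h) x = lconj g (lconj h x).
Proof. by rewrite /lconj invMg conjgM. Qed.

Lemma lconjJ g x y : lconj g (lconj x y) = lconj (lconj g x) (lconj g y).
Proof. by rewrite /lconj -conjVg conjJg. Qed.

Lemma wact_ext g u v : ext_rel u v -> ext_rel (wact g u) (wact g v).
Proof.
elim=> {u v} [w|u v _|u v w _ + _|u u' v v' _ Hu _ Hv|[[x y] b]|x x' y|x y y'|x].
- exact: er_refl.
- exact: er_sym.
- exact: er_trans.
- by rewrite /wact !map_cat; apply: er_cat.
- exact: er_free.
- by rewrite /wact /= lconjM !(lconjJ g x); apply: er_tens_l.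
- by rewrite /wact /= lconjM !(lconjJ g y); apply: er_tens_r.
- exact: er_nabla.
Qed.

Lemma kappa_cat u v : kappa (u ++ v) = kappa u * kappa v.
Proof. by elim: u => [|a u IHu] /=; rewrite ?mul1g // IHu mulgA. Qed.

Lemma lcommE x y : lcomm x y = x * lconj y x^-1.
Proof. by rewrite /lcomm /lconj /conjg invgK !mulgA. Qed.

Lemma kappa_ext u v : ext_rel u v -> kappa u = kappa v.
Proof.
elim=> {u v} // [u v w _ -> _ -> //|u u' v v' _ Hu _ Hv|[[x y] b]|x x' y|x y y'|x].
- by rewrite !kappa_cat Hu Hv.
- by case: b => /=; rewrite mulg1 ?mulVg ?mulgV.
- rewrite /= !mulg1 /lcomm /lconj /conjg !invgK.
  by rewrite !invMg !invgK !mulgA !mulgVK.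
- rewrite /= !mulg1 /lcomm /lconj /conjg !invgK.
  by rewrite !invMg !invgK !mulgA !mulgVK.
- by rewrite /= /lcomm !mulg1 mulgK mulgV.
Qed.

Definition emul (a b : extsq) : extsq := cls (rep a ++ rep b).
Definition einv (a : extsq) : extsq := cls (winv (rep a)).

Lemma rep_cls w : ext_rel (rep (cls w)) w.
Proof. by apply/clsP; rewrite repK. Qed.

Lemma emul_cls u v : emul (cls u) (cls v) = cls (u ++ v).
Proof. by apply/clsP/er_cat; apply: rep_cls. Qed.

Lemma einv_cls u : einv (cls u) = cls (winv u).
Proof. by apply/clsP/winv_ext/rep_cls. Qed.

Lemma emulA : associative emul.
Proof. by move=> a b c; rewrite -(repK a) -(repK b) -(repK c) !emul_cls catA. Qed.

Lemma emul1 : left_id (cls [::]) emul.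
Proof. by move=> a; rewrite -(repK a) emul_cls. Qed.

Lemma emulr1 : right_id (cls [::]) emul.
Proof. by move=> a; rewrite -(repK a) emul_cls cats0. Qed.

Lemma emulrV : right_inverse (cls [::]) einv emul.
Proof.
by move=> a; rewrite -(repK a) einv_cls emul_cls; apply/clsP/cat_winv.
Qed.

Lemma emulV : left_inverse (cls [::]) einv emul.
Proof.
move=> a; rewrite -(repK a) einv_cls emul_cls -{2}[rep a]winvK.
exact/clsP/cat_winv.
Qed.

HB.instance Definition _ := isGroup.Build extsq emulA emul1 emulr1 emulV emulrV.

Lemma cls_cat u v : cls (u ++ v) = cls u * cls v.
Proof. by rewrite -emul_cls. Qed.

Lemma cls_nil : cls [::] = 1. Proof. by []. Qed.

Lemma cls_wpow w n : cls (wpow w n) = cls w ^+ n.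
Proof. by elim: n => // n IHn; rewrite /wpow /= cls_cat IHn expgS. Qed.

Definition ewedge g h : extsq := cls (gen g h).
Definition eact g (a : extsq) : extsq := cls (wact g (rep a)).
Definition ekappa (a : extsq) : gT := kappa (rep a).

Lemma eact_cls g w : eact g (cls w) = cls (wact g w).
Proof. by apply/clsP/wact_ext/rep_cls. Qed.

Lemma ekappa_cls w : ekappa (cls w) = kappa w.
Proof. exact/kappa_ext/rep_cls. Qed.

Lemma eactM g : {morph eact g : a b / a * b}.
Proof.
move=> a b; rewrite -(repK a) -(repK b) -cls_cat !eact_cls.
by rewrite /wact map_cat cls_cat.
Qed.

Lemma eact_mul g h a : eact (g * h) a = eact g (eact h a).
Proof.
rewrite -(repK a) !eact_cls; congr cls; rewrite /wact -map_comp.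
by apply: eq_map => b /=; rewrite !lconj_mul.
Qed.

Lemma eact1 a : eact 1 a = a.
Proof.
rewrite -{2}(repK a) -{1}(repK a) eact_cls /wact map_id_in // => -[[x y] b] _ /=.
by rewrite /lconj invg1 !conjg1.
Qed.

Lemma eactg1 g : eact g 1 = 1.
Proof. by apply: (mulgI (eact g 1)); rewrite -eactM !mulg1. Qed.

Lemma eactV g a : eact g a^-1 = (eact g a)^-1.
Proof. by apply: (mulgI (eact g a)); rewrite -eactM !mulgV eactg1. Qed.

Lemma ekappaM : {morph ekappa : a b / a * b}.
Proof.
move=> a b; rewrite -(repK a) -(repK b) -cls_cat !ekappa_cls.
exact: kappa_cat.
Qed.

Lemma ekappa_wedge g h : ekappa (ewedge g h) = lcomm g h.
Proof. by rewrite ekappa_cls /= mulg1. Qed.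

Lemma eact_wedge g x y : eact g (ewedge x y) = ewedge (lconj g x) (lconj g y).
Proof. exact: eact_cls. Qed.

Lemma wedgeMl g g' h : ewedge (g * g') h = eact g (ewedge g' h) * ewedge g h.
Proof. by rewrite eact_wedge -cls_cat; apply/clsP/er_tens_l. Qed.

Lemma wedgeMr g h h' : ewedge g (h * h') = ewedge g h * eact h (ewedge g h').
Proof. by rewrite eact_wedge -cls_cat; apply/clsP/er_tens_r. Qed.

Lemma wedgexx x : ewedge x x = 1.
Proof. exact/clsP/er_nabla. Qed.

Lemma wedge1l h : ewedge 1 h = 1.
Proof.
by apply: (mulgI (ewedge 1 h)); rewrite -{1}[ewedge 1 h]eact1 -wedgeMl !mulg1.
Qed.

Lemma wedgeC x y : (ewedge x y)^-1 = ewedge y x.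
Proof.
apply: mulg1_eq.
(* Expanding both entries leaves the action of [y] on [ewedge x y * ewedge y x]. *)
have := wedgexx (y * x); rewrite wedgeMl !wedgeMr !wedgexx !eactg1 mulg1 mul1g.
by rewrite -eactM => /(congr1 (eact y^-1)); rewrite -eact_mul mulVg eact1 eactg1.
Qed.

(** Inverse letters are absorbed by [wedgeC]: the inverse of a wedge is the wedge with its entries
    swapped. *)
Lemma extsq_ind (P : extsq -> Prop) :
  P 1 -> (forall x y a, P a -> P (ewedge x y * a)) -> forall a, P a.
Proof.
move=> P1 Pw a; rewrite -(repK a); elim: (rep a) => // -[[x y] b] w IHw.
rewrite -cat1s cls_cat; case: b; last exact: Pw.
rewrite [cls _](_ : _ = ewedge y x); first exact: Pw.
by rewrite -wedgeC -[RHS]/(einv (cls (gen x y))) einv_cls.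
Qed.

(* Expanding [ewedge (a * a') (b * b')] with either factor first gives two
   expressions whose comparison is exactly this identity. *)
Lemma wedge_conj_gen a b x y :
  ewedge a b * ewedge x y = eact (lcomm a b) (ewedge x y) * ewedge a b.
Proof.
have swap x' y' : eact (a * b) (ewedge x' y') * ewedge a b
    = ewedge a b * eact (b * a) (ewedge x' y').
  have : ewedge (a * x') (b * y') = ewedge (a * x') (b * y') by [].
  rewrite {1}wedgeMl 2!(wedgeMr _ b) [RHS]wedgeMr 2!(wedgeMl a).
  rewrite !eactM -!eact_mul !mulgA => /mulIg.
  by rewrite -!mulgA => /mulgI.
have := swap (lconj (b * a)^-1 x) (lconj (b * a)^-1 y).
rewrite -eact_wedge -!eact_mul mulgV eact1 => <-; congr (eact _ _ * _).
by rewrite /lcomm invMg !mulgA.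
Qed.

Lemma wedge_conj a b c : ewedge a b * c = eact (lcomm a b) c * ewedge a b.
Proof.
elim/extsq_ind: c => [|x y c IHc]; first by rewrite eactg1 mulg1 mul1g.
by rewrite eactM mulgA wedge_conj_gen -mulgA IHc mulgA.
Qed.

(** The Peiffer identity of the crossed module; it passes from generators to all [u] by
    multiplicativity of [ekappa]. *)
Lemma extsq_conj (u c : extsq) : u * c = eact (ekappa u) c * u.
Proof.
elim/extsq_ind: u c => [|x y u IHu] c.
  by rewrite -cls_nil ekappa_cls /= eact1 cls_nil mulg1 mul1g.
rewrite ekappaM ekappa_wedge eact_mul -mulgA IHu !mulgA.
by rewrite (wedge_conj x y (eact _ _)).
Qed.

Lemma wedgeVl g h : ewedge g^-1 h = (eact g^-1 (ewedge g h))^-1.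
Proof.
by apply/esym/mulg1_eq; rewrite -wedgeMl mulVg wedge1l.
Qed.

Lemma wedgeVr g h : ewedge g h^-1 = (eact h^-1 (ewedge g h))^-1.
Proof.
by rewrite -eactV wedgeC -(wedgeC h^-1) wedgeVl invgK.
Qed.

(* With [lcomm g h = g * (h g^-1 h^-1)], the left side reduces to
   [ewedge g^-1 (h^-1 * k * h)], which is then expanded on the right. *)
Lemma wedge_lcomm g h k :
  ewedge (lcomm g h) k = ewedge g h * (eact k (ewedge g h))^-1.
Proof.
have actgV y : eact g (ewedge g^-1 y) = (ewedge g y)^-1.
  by rewrite wedgeVl eactV -eact_mul mulgV eact1.
have acthV : eact h (ewedge g^-1 h^-1) = (ewedge g^-1 h)^-1.
  by rewrite wedgeVr eactV -eact_mul mulgV eact1.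
rewrite lcommE wedgeMl.
have -> : ewedge (lconj h g^-1) k = eact h (ewedge g^-1 (h^-1 * k * h)).
  rewrite eact_wedge !lconjM /lconj /conjg !invgK !mulgA.
  by rewrite !(mulgV, mulgK, mulVg, mul1g, mulgVK).
rewrite wedgeMr (wedgeMr _ h^-1) !eactM acthV -!eact_mul eactV actgV invgK.
rewrite !(mulgA (g * h)) mulgK actgV -!mulgA; congr (_ * _).
apply: (mulgI (ewedge g k)); rewrite mulKVg wedge_conj -eactV -actgV -!eact_mul.
by rewrite /lcomm !mulgVK.
Qed.

(** Extends [wedge_lcomm] from generators to products, with [wedge_conj] restoring the order of the
    factors. It is the source of every descent in the filtration. *)
Lemma wedge_kappa (u : extsq) k : ewedge (ekappa u) k = u * (eact k u)^-1.
Proof.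
elim/extsq_ind: u => [|x y u IHu].
  by rewrite -cls_nil ekappa_cls /= wedge1l cls_nil eactg1 mulgV.
rewrite ekappaM ekappa_wedge wedgeMl IHu wedge_lcomm (eactM k) invgM.
by rewrite [LHS]mulgA -wedge_conj !mulgA.
Qed.

End ExteriorSquareGroup.

(** * The filtration by lower central terms, and finiteness *)

Section Filtration.
Variable gT : finGroupType.
Implicit Types (g h x y : gT) (n : nat) (a b u v : extsq gT).
Local Notation G := [set: gT].

(** The subgroup generated by wedges with first entry in ['L_n(G)], kept as a predicate because
    finiteness of [extsq gT] is still to be proved. *)
Inductive filt n : extsq gT -> Prop :=
| filt1 : filt n 1
| filt_wedge y x : y \in 'L_n(G) -> filt n (ewedge y x)
| filtM a b : filt n a -> filt n b -> filt n (a * b)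
| filtV a : filt n a -> filt n a^-1.

Lemma filt_top a : filt 1 a.
Proof.
elim/extsq_ind: a => [|x y a Fa]; first exact: filt1.
by apply: filtM => //; apply: filt_wedge; rewrite lcn1 inE.
Qed.

Lemma filt_trivial n a : 'L_n(G) = 1 -> filt n a -> a = 1.
Proof.
move=> L1; elim=> {a} // [y x|a b _ -> _ ->|a _ ->].
- by rewrite L1 => /set1P ->; rewrite wedge1l.
- by rewrite mulg1.
- by rewrite invg1.
Qed.

Lemma filt_eact n g a : filt n a -> filt n (eact g a).
Proof.
elim=> {a} [|y x Ly|a b _ ? _ ?|a _ ?].
- by rewrite eactg1; apply: filt1.
- rewrite eact_wedge; apply: filt_wedge.
  rewrite /lconj memJ_norm // groupV.
  by apply: (subsetP (lcn_norm n G)); rewrite inE.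
- by rewrite eactM; apply: filtM.
- by rewrite eactV; apply: filtV.
Qed.

Lemma ekappaV a : ekappa a^-1 = (ekappa a)^-1.
Proof. by apply/esym/mulg1_eq; rewrite -ekappaM mulgV -(cls_nil gT) ekappa_cls. Qed.

Lemma filt_ekappa n a : 0 < n -> filt n a -> ekappa a \in 'L_n.+1(G).
Proof.
case: n => // n _; elim=> {a} [|y x Ly|a b _ ? _ ?|a _ ?].
- by rewrite -(cls_nil gT) ekappa_cls group1.
- have -> : ekappa (ewedge y x) = [~ y^-1, x^-1].
    by rewrite ekappa_wedge /lcomm commgEl /conjg !invgK !mulgA.
  by rewrite lcnSn mem_commg ?groupV // inE.
- by rewrite ekappaM groupM.
- by rewrite ekappaV groupV.
Qed.

Lemma filt_commg n g a : 0 < n -> filt n a -> filt n.+1 (a * (eact g a)^-1).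
Proof. by move=> n_gt0 Fa; rewrite -wedge_kappa; apply/filt_wedge/filt_ekappa. Qed.

Lemma extsqJ a b : a ^ b = eact (ekappa b^-1) a.
Proof. by rewrite /conjg mulgA [b^-1 * a]extsq_conj mulgVK. Qed.

Lemma filtJ n a b : filt n a -> filt n (a ^ b).
Proof. by rewrite extsqJ; apply: filt_eact. Qed.

Definition congf n a b := filt n (a^-1 * b).

Lemma congf_refl n a : congf n a a.
Proof. by rewrite /congf mulVg; apply: filt1. Qed.

Lemma congf_sym n a b : congf n a b -> congf n b a.
Proof. by move/filtV; rewrite invgM invgK. Qed.

Lemma congf_trans n b a c : congf n a b -> congf n b c -> congf n a c.
Proof. by move=> ab bc; have := filtM ab bc; rewrite /congf mulgA mulgK. Qed.

Lemma congfM n a a' b b' :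
  congf n a a' -> congf n b b' -> congf n (a * b) (a' * b').
Proof.
move=> aa bb; apply: (congf_trans (b := a' * b)); last first.
  by rewrite /congf invgM -mulgA mulKg.
by have := filtJ b aa; rewrite /congf /conjg invgM !mulgA.
Qed.

Lemma congf_eact n g a : 0 < n -> filt n a -> congf n.+1 (eact g a) a.
Proof.
move=> n_gt0 Fa; have := filtJ a (filt_commg g n_gt0 Fa).
by rewrite /conjg !mulgA mulVg mul1g.
Qed.

Lemma congf_comm n a b : 0 < n -> filt n a -> congf n.+1 (a * b) (b * a).
Proof.
move=> n_gt0 Fa; have := congf_eact (ekappa b^-1) n_gt0 Fa.
by rewrite -extsqJ /congf /conjg !invgM invgK !mulgA.
Qed.

(** The action is trivial modulo the next layer, so the wedge becomes linear in [y] there. Taking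
    [i] to be the order of the group shows that the generators of a layer are torsion. *)
Lemma congf_wedgeX n y x i : 0 < n -> y \in 'L_n(G) ->
  congf n.+1 (ewedge y x ^+ i) (ewedge (y ^+ i) x).
Proof.
move=> n_gt0 Ly; elim: i => [|i IHi].
  by rewrite !expg0 wedge1l; apply: congf_refl.
rewrite expgSr (expgS y) wedgeMl; apply: congfM (congf_refl _ _).
apply/(congf_trans IHi)/congf_sym/congf_eact => //.
exact/filt_wedge/groupX.
Qed.

(* Factors commute modulo the next term of the filtration, so a product can be
   sorted along [l]; [W] lists the sorted monomials with exponents below
   [#|gT|]. *)
Lemma filt_collect n (l : seq (extsq gT)) : 0 < n ->
  (forall t, t \in l -> filt n t /\ congf n.+1 1 (t ^+ #|gT|)) ->
  exists W : seq (extsq gT), forall s, {subset s <= l} ->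
    exists2 w, w \in W & congf n.+1 w (\prod_(t <- s) t).
Proof.
move=> n_gt0; elim: l => [|t l IHl] lP.
  exists [:: 1] => -[|a s] sl; last by have := sl a (mem_head _ _).
  by exists 1; rewrite ?mem_head // big_nil; apply: congf_refl.
have [|W WP] := IHl; first by move=> a la; apply: lP; rewrite inE la orbT.
have [Ft tq] := lP t (mem_head _ _).
exists [seq t ^+ i * w | i <- iota 0 #|gT|, w <- W] => s sl.
have [i [s' s'l cs]] : exists i, exists2 s', {subset s' <= l} &
    congf n.+1 (t ^+ i * \prod_(a <- s') a) (\prod_(a <- s) a).
  elim: s sl => [|a s IHs] sl.
    by exists 0, [::] => //; rewrite !big_nil expg0 mulg1; apply: congf_refl.
  have [|i [s' s'l cs]] := IHs.
    by move=> b sb; apply: sl; rewrite inE sb orbT.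
  rewrite big_cons; have := sl a (mem_head _ _); rewrite inE => /predU1P[->|la].
    exists i.+1, s' => //; rewrite expgS -mulgA.
    by apply: congfM cs; apply: congf_refl.
  exists i, (a :: s'); first by move=> b; rewrite inE => /predU1P[-> //|/s'l].
  apply: congf_trans (congfM (congf_refl _ a) cs); rewrite big_cons !mulgA.
  apply: congfM (congf_refl _ _); apply/congf_sym/congf_comm => //.
  by have [] := lP a (sl a (mem_head _ _)).
have [w Ww cw] := WP s' s'l.
exists (t ^+ (i %% #|gT|) * w).
  apply/allpairsP; exists (i %% #|gT|, w); split=> //=.
  by rewrite mem_iota add0n ltn_mod; apply/card_gt0P; exists 1.
apply: congf_trans cs; apply: congfM => //.
rewrite {2}(divn_eq i #|gT|) expgnDr -{1}[t ^+ (i %% _)]mul1g mulnC expgM.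
apply: congfM (congf_refl _ _); elim: (i %/ _) => [|j IHj]; first exact: congf_refl.
by rewrite expgS -[1]mulg1; apply: congfM.
Qed.

Lemma filt_layer_finite n : 0 < n ->
  exists W : seq (extsq gT),
    forall a, filt n a -> exists2 w, w \in W & congf n.+1 w a.
Proof.
move=> n_gt0; pose l0 := [seq ewedge y x | y <- enum 'L_n(G), x <- enum gT].
have l0P y x : y \in 'L_n(G) -> ewedge y x \in l0.
  by move=> Ly; apply/allpairsP; exists (y, x); rewrite !mem_enum.
(* Closing the generators under inversion makes every element of the layer a plain product over a
   sequence. *)
pose l := l0 ++ [seq t^-1 | t <- l0].
have lV t : t \in l -> t^-1 \in l.
  rewrite !mem_cat => /orP[l0t|/mapP[a l0a ->]].
    by rewrite map_f ?orbT.
  by rewrite invgK l0a.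
have [|W WP] := filt_collect (l := l) n_gt0.
  have l0Q t : t \in l0 -> filt n t /\ congf n.+1 1 (t ^+ #|gT|).
    case/allpairsP=> -[y x] /= [+ _ ->]; rewrite mem_enum => Ly.
    split; first exact: filt_wedge.
    apply: congf_sym; have := congf_wedgeX x #|gT| n_gt0 Ly.
    suff -> : y ^+ #|gT| = 1 by rewrite wedge1l.
    by apply/eqP; rewrite -order_dvdn -cardsT order_dvdG ?inE.
  move=> t; rewrite mem_cat => /orP[/l0Q //|/mapP[a /l0Q[Fa aq] ->]].
  split; first exact: filtV.
  move: aq; rewrite /congf invg1 !mul1g expVgn; exact: filtV.
exists W => a Fa.
suff [s sl ->] : exists2 s, {subset s <= l} & a = \prod_(t <- s) t by apply: WP.
elim: a / Fa => [|y x Ly|a b _ [s sl ->] _ [s' sl' ->]|a _ [s sl ->]].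
- by exists [::]; rewrite ?big_nil.
- exists [:: ewedge y x]; last by rewrite big_seq1.
  by move=> t; rewrite inE => /eqP ->; rewrite mem_cat l0P.
- exists (s ++ s'); last by rewrite big_cat.
  by move=> t; rewrite mem_cat => /orP[/sl|/sl'].
- elim: s sl => [|t s IHs] sl; first by exists [::]; rewrite // !big_nil invg1.
  have [|s' sl' e] := IHs; first by move=> b sb; apply: sl; rewrite inE sb orbT.
  exists (rcons s' t^-1); last by rewrite big_cons invgM e -cats1 big_cat big_seq1.
  move=> b; rewrite mem_rcons inE => /predU1P[->|/sl' //].
  by apply/lV/sl/mem_head.
Qed.

Lemma extsq_finite c : 'L_c(G) = 1 -> exists s : seq (extsq gT), forall a, a \in s.
Proof.
move=> L1.
(* Here [d] bounds the number of layers left before the filtration becomes trivial. *)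
suff fin d n : 0 < n -> c <= d + n ->
    exists s : seq (extsq gT), forall a, filt n a -> a \in s.
  have [//| |s sP] := fin c 1%N; first by rewrite addn1.
  by exists s => a; apply/sP/filt_top.
elim: d n => [|d IHd] n n_gt0 le_c.
  exists [:: 1] => a Fa; rewrite inE; apply/eqP/(filt_trivial (n := n)) => //.
  by apply/eqP; rewrite -subG1 -L1 lcn_sub_leq.
have [W WP] := filt_layer_finite n_gt0.
have [//| |s sP] := IHd n.+1; first by rewrite addnS -addSn.
exists [seq w * v | w <- W, v <- s] => a /WP[w Ww /sP sw].
by apply/allpairsP; exists (w, w^-1 * a); rewrite /= mulVKg.
Qed.

End Filtration.

(** * A finite permutation model of the exterior square with its action *)

Section PermutationModel.
Variables (gT : finGroupType) (s : seq (extsq gT)).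
Hypothesis s_full : forall a : extsq gT, a \in s.
Implicit Types (g h x y : gT) (a b : extsq gT).
Local Notation G := [set: gT].
Local Notation X := (seq_sub s).

Let elt a : X := SeqSub (s_full a).

Lemma rmul_inj a : injective (fun x : X => elt (val x * a)).
Proof. by move=> x y /(congr1 val) /mulIg /val_inj. Qed.

Lemma act_inj g : injective (fun x : X => elt (eact g^-1 (val x))).
Proof.
move=> x y /(congr1 val) /= /(congr1 (eact g)).
by rewrite -!eact_mul mulgV !eact1 => /val_inj.
Qed.

(* Permutations compose from left to right, so [rho] is right multiplication and
   [beta g] acts by [g^-1]: this makes both of them morphisms. *)
Definition rho a : {perm X} := perm (@rmul_inj a).
Definition beta g : {perm X} := perm (@act_inj g).

Lemma rhoE a (x : X) : val (rho a x) = val x * a. Proof. by rewrite permE. Qed.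

Lemma betaE g (x : X) : val (beta g x) = eact g^-1 (val x).
Proof. by rewrite permE. Qed.

Lemma rhoM a b : rho (a * b) = rho a * rho b.
Proof. by apply/permP=> x; apply: val_inj; rewrite permM !rhoE mulgA. Qed.

Lemma rho1 : rho 1 = 1.
Proof. by apply: (mulgI (rho 1)); rewrite -rhoM !mulg1. Qed.

Lemma rhoV a : rho a^-1 = (rho a)^-1.
Proof. by apply/esym/mulg1_eq; rewrite -rhoM mulgV rho1. Qed.

Lemma rhoX a n : rho (a ^+ n) = rho a ^+ n.
Proof. by elim: n => [|n IHn]; rewrite ?rho1 // !expgS rhoM IHn. Qed.

Lemma rho_inj : injective rho.
Proof.
by move=> a b /permP/(_ (elt 1)) /(congr1 val); rewrite !rhoE /= !mul1g.
Qed.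

Lemma betaM g h : beta (g * h) = beta g * beta h.
Proof.
by apply/permP=> x; apply: val_inj; rewrite permM !betaE -eact_mul invMg.
Qed.

Lemma beta1 : beta 1 = 1.
Proof. by apply: (mulgI (beta 1)); rewrite -betaM !mulg1. Qed.

Lemma betaX g n : beta (g ^+ n) = beta g ^+ n.
Proof. by elim: n => [|n IHn]; rewrite ?beta1 // !expgS betaM IHn. Qed.

Lemma rhoJ a g : rho a ^ beta g = rho (eact g^-1 a).
Proof.
apply: (mulgI (beta g)); rewrite /conjg mulVKg.
apply/permP=> x; apply: val_inj.
by rewrite !permM rhoE !betaE rhoE eactM.
Qed.

Definition rfilt n := [set rho (val x) | x : X & boolp.asbool (filt n (val x))].

Lemma rfiltP n (r : {perm X}) :
  reflect (exists2 a, filt n a & r = rho a) (r \in rfilt n).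
Proof.
apply: (iffP imsetP) => [[x]|[a Fa ->]].
  by rewrite inE => /boolp.asboolP Fx ->; exists (val x).
by exists (elt a) => //; rewrite inE; apply/boolp.asboolP.
Qed.

Lemma rfilt_group_set n : group_set (rfilt n).
Proof.
apply/group_setP; split.
  by apply/rfiltP; exists 1; [exact: filt1 | rewrite rho1].
move=> _ _ /rfiltP[a Fa ->] /rfiltP[b Fb ->]; apply/rfiltP.
by exists (a * b); [apply: filtM | rewrite rhoM].
Qed.
Canonical rfilt_group n := Group (rfilt_group_set n).

(* A quotient of the semidirect product of [extsq gT] by [<[g]>]. *)
Definition extL g := <[beta g]> <*> rfilt 1.

Lemma norm_rfilt n g : extL g \subset 'N(rfilt n).
Proof.
rewrite join_subG cycle_subG; apply/andP; split.
  apply/normP/eqP; rewrite eqEcard cardJg leqnn andbT.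
  apply/subsetP=> _ /imsetP[_ /rfiltP[a Fa ->] ->]; rewrite rhoJ.
  by apply/rfiltP; exists (eact g^-1 a) => //; apply: filt_eact.
apply/subsetP=> _ /rfiltP[b _ ->]; apply/normP/eqP.
rewrite eqEcard cardJg leqnn andbT.
apply/subsetP=> _ /imsetP[_ /rfiltP[a Fa ->] ->].
apply/rfiltP; exists (a ^ b); first exact: filtJ.
by rewrite /conjg !rhoM rhoV.
Qed.

(** Both kinds of generators of [extL g] conjugate through the action of [gT]: [beta] by
    construction, [rho] by the Peiffer identity. Hence [congf_eact] applies to each. *)
Lemma rfilt_comm n g : 0 < n -> [~: rfilt n, extL g] \subset rfilt n.+1.
Proof.
move=> n_gt0.
have [nb nr] : <[beta g]> \subset 'N(rfilt n.+1) /\ rfilt 1 \subset 'N(rfilt n.+1).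
  by have := norm_rfilt n.+1 g; rewrite join_subG => /andP[].
have nn : rfilt n \subset 'N(rfilt n.+1).
  apply: subset_trans nr; apply/subsetP=> _ /rfiltP[a _ ->]; apply/rfiltP.
  by exists a => //; apply: filt_top.
rewrite -quotient_cents2 ?norm_rfilt // quotientY // centY subsetI.
rewrite !quotient_cents2 // !gen_subG; apply/andP; split;
  apply/subsetP=> _ /imset2P[r1 r2 + + ->].
  case/rfiltP=> a Fa -> /cycleP[i ->]; rewrite -betaX commgEl rhoJ -rhoV -rhoM.
  apply/rfiltP; exists (a^-1 * eact (g ^+ i)^-1 a) => //.
  by apply: congf_sym; apply: congf_eact.
case/rfiltP=> a Fa -> /rfiltP[b _ ->]; apply/rfiltP; exists (a^-1 * a ^ b).
  by rewrite extsqJ; apply: congf_sym; apply: congf_eact.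
by rewrite commgEl /conjg -!rhoV -!rhoM.
Qed.

(** The comparison starts at index 2, since [beta g] itself need not lie in [rfilt 1]; the base case
    uses that [<[beta g]>] is abelian. *)
Lemma lcn_extL n g : 'L_n.+2(extL g) \subset rfilt n.+2.
Proof.
elim: n => [|n IHn].
  by rewrite lcn2; apply: der1_joing_cycle; [apply: norm_rfilt | apply: rfilt_comm].
rewrite lcnSn; apply: subset_trans (rfilt_comm g (ltn0Sn n.+1)).
exact: commSg.
Qed.

(** Moving the powers of [beta] to the left turns the remaining factors into the expansion of
    [ewedge (g ^+ n) h] by [wedgeMl]. *)
Lemma beta_rhoX g h n : 
  (beta g^-1 * rho (ewedge g h)) ^+ n = beta (g ^- n) * rho (ewedge (g ^+ n) h).
Proof.
elim: n => [|n IHn].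
  by rewrite !expg0 invg1 beta1 wedge1l rho1 mulg1.
rewrite expgSr IHn; apply/permP=> x; apply: val_inj.
rewrite !permM !(rhoE, betaE) !invgK expgS wedgeMl eactM eact_mul.
by rewrite -!mulgA.
Qed.

End PermutationModel.

(** * The exponent bound *)

Lemma wedge_expg (p k : nat) (gT : finGroupType) (g h : gT) :
  prime p -> 'L_p([set: gT]) = 1 -> g ^+ (p ^ k) = 1 ->
  ewedge g h ^+ (p ^ k) = 1.
Proof.
move=> p_pr L1 gq; have [s s_full] := extsq_finite L1.
have p_gt1 := prime_gt1 p_pr; have def_p : p.-2.+2 = p by case: (p) p_gt1 => [|[]].
set e := ewedge g h; pose b := beta s_full g^-1; pose r := rho s_full e.
have Lb : b \in extL s_full g^-1.
  by apply: (subsetP (joing_subl _ _)); apply: cycle_id.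
have Lr : r \in extL s_full g^-1.
  apply: (subsetP (joing_subr _ _)); apply/rfiltP; exists e => //.
  exact: filt_top.
(* Writing [p] as [p.-2.+2] fits [lcn_extL] and yields the class bound [p.-2.+1], which is less than
   [p]. *)
have LL1 : 'L_p.-2.+2(extL s_full g^-1) = 1.
  apply/eqP; rewrite -subG1; apply: subset_trans (lcn_extL _ _ _) _.
  apply/subsetP=> _ /rfiltP[a Fa ->]; rewrite def_p in Fa.
  by rewrite (filt_trivial L1 Fa) rho1 inE.
apply: (rho_inj (s_full := s_full)); rewrite rhoX rho1 -/r.
(* Both [b] and [b * r] have trivial [q]-th power, the second by [beta_rhoX], so [expg_eq_mulVg]
   applies to them. *)
have -> : r = b^-1 * (b * r) by rewrite mulKg.
apply: (expg_eq_mulVg p_pr _ LL1) => //; first by rewrite -[X in _ < X]def_p.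
  exact: groupM.
rewrite beta_rhoX gq wedge1l rho1 mulg1 invg1 beta1.
by rewrite -betaX expgVn gq invg1 beta1.
Qed.

(** The wedges generate and have trivial [q]-th power by [wedge_expg]; the class bound on their
    permutation image extends this to all elements. *)
Lemma extsq_expg (p k : nat) (gT : finGroupType) :
  prime p -> 'L_p([set: gT]) = 1 -> (forall g : gT, g ^+ (p ^ k) = 1) ->
  forall a : extsq gT, a ^+ (p ^ k) = 1.
Proof.
move=> p_pr L1 Gq a; have [s s_full] := extsq_finite L1.
have p_gt1 := prime_gt1 p_pr; have def_p : p.-2.+2 = p by case: (p) p_gt1 => [|[]].
pose A := [set rho s_full (ewedge u.1 u.2) | u : gT * gT].
apply: (rho_inj (s_full := s_full)); rewrite rhoX rho1.
(* For [g = 1] the cyclic factor of [extL] is trivial, leaving only the image of [extsq gT]. *)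
have sAL : <<A>> \subset extL s_full 1.
  rewrite gen_subG; apply/subsetP=> _ /imsetP[u _ ->].
  apply: (subsetP (joing_subr _ _)); apply/rfiltP.
  by exists (ewedge u.1 u.2) => //; apply: filt_top.
have LA1 : 'L_p.-2.+2(<<A>>) = 1.
  apply/eqP; rewrite -subG1; apply: subset_trans (lcnS _ sAL) _.
  apply: subset_trans (lcn_extL _ _ _) _.
  apply/subsetP=> _ /rfiltP[b Fb ->]; rewrite def_p in Fb.
  by rewrite (filt_trivial L1 Fb) rho1 inE.
apply: (expg_gen_lcn p_pr _ LA1); first by rewrite -[X in _ < X]def_p.
  by move=> _ /imsetP[u _ ->]; rewrite -rhoX wedge_expg // rho1.
elim/extsq_ind: a => [|x y a Aa]; first by rewrite rho1 group1.
rewrite rhoM groupM // mem_gen //.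
by apply/imsetP; exists (x, y).
Qed.

Theorem theorem4p6 (p : nat) (gT : finGroupType) :
  prime p -> odd p -> p.-group [set: gT] -> nil_class [set: gT] <= p.-1 ->
  ext_exp_dvd gT (exponent [set: gT]) /\ mult_exp_dvd gT (exponent [set: gT]).
Proof.
move=> p_pr _ pG classG.
have L1 : 'L_p([set: gT]) = 1.
  rewrite -(prednK (prime_gt0 p_pr)); apply/lcn_nil_classP => //.
  exact: pgroup_nil pG.
have [|k expG] := @p_natP p (exponent [set: gT]); first by rewrite pnat_exponent.
suff exp_ext (w : word gT) : ext_rel (wpow w (exponent [set: gT])) [::].
  by split=> w // _.
apply: (iffLR (clsP _ _)); rewrite cls_wpow cls_nil expG; apply: extsq_expg => // g.
by rewrite -expG expg_exponent ?inE.
Qed.
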